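(* There is no 3-dimensional $\phi$-recurrent $N(k)$-contact metric manifold ($k$ any real constant) which is neither symmetric nor locally $\phi$-symmetric.
   Context: Manifolds are smooth and non-empty. A contact metric manifold is a $(2n+1)$-dimensional manifold $M$, $n\ge 1$, with a 1-form $\eta$ satisfying $\eta\wedge(d\eta)^n\neq 0$ everywhere, the characteristic vector field $\xi$ (determined by $\eta(\xi)=1$, $d\eta(\xi,\cdot)=0$), a Riemannian metric $g$ and a $(1,1)$-tensor field $\phi$ such that for all vector fields $X,Y$: $\eta(X)=g(X,\xi)$, $d\eta(X,Y)=g(X,\phi Y)$, $\phi^2X=-X+\eta(X)\xi$. Convention: $d\eta(X,Y)=\frac12\big(X\eta(Y)-Y\eta(X)-\eta([X,Y])\big)$. Let $\nabla$ be the Levi-Civita connection of $g$ and $R(X,Y)Z=\nabla_X\nabla_YZ-\nabla_Y\nabla_XZ-\nabla_{[X,Y]}Z$. The contact metric manifold is an $N(k)$-contact metric manifold, for a real constant $k$, if $R(X,Y)\xi=k[\eta(Y)X-\eta(X)Y]$ for all vector fields $X,Y$. It is $\phi$-recurrent if there exists a non-zero 1-form $A$ (i.e. not identically zero) such that $\phi^2((\nabla_WR)(X,Y)Z)=A(W)R(X,Y)Z$ for all vector fields $X,Y,Z,W$ (not necessarily orthogonal to $\xi$). It is symmetric (in the local sense) if $\nabla R=0$. It is locally $\phi$-symmetric if $\phi^2((\nabla_WR)(X,Y)Z)=0$ for all vector fields $X,Y,Z,W$ orthogonal to $\xi$. *)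

(* Defs.v *)
From HB Require Import structures.
From mathcomp Require Import all_boot all_order all_algebra all_fingroup.
From mathcomp Require Import all_classical all_reals all_analysis.
From mathcomp Require Import ring.
Set Implicit Arguments.
Unset Strict Implicit.
Unset Printing Implicit Defensive.
Import Order.TTheory GRing.Theory Num.Theory.
Import numFieldNormedType.Exports.
Local Open Scope classical_set_scope.
Local Open Scope ring_scope.

Section SmoothOn.
Variables (R : realType) (d : nat) (W : normedModType R).
Implicit Types (U : set 'rV[R]_d) (f : 'rV[R]_d -> W).

Fixpoint Ck (k : nat) U f : Prop :=
  {in U, continuous f} /\
  if k is k'.+1 then
    forall i : 'I_d,
      {in U, forall x, derivable f x (delta_mx 0 i)} /\
      Ck k' U (fun x => 'D_(delta_mx 0 i) f x)
  else True.

(* Meant for open U only: 'D_v f x then depends on the values of f on U. *)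
Definition smooth_on U f := forall k, Ck k U f.

Lemma Ck_continuous k U f : Ck k U f -> {in U, continuous f}.
Proof. by case: k => [|k] []. Qed.

Lemma CkS k U f : Ck k.+1 U f -> Ck k U f.
Proof.
elim: k f => [|k IH] f [cf df]; split=> // i.
by have [? /IH] := df i.
Qed.

Lemma Ck_eq k U f g : open U -> {in U, f =1 g} -> Ck k U f -> Ck k U g.
Proof.
move=> oU.
have near_fg (h h' : 'rV[R]_d -> W) x :
    {in U, h =1 h'} -> x \in U -> \near x, h x = h' x.
  move=> hh' /set_mem Ux; have := open_nbhs_nbhs (conj oU Ux).
  by apply: filterS => y /mem_set /hh'.
elim: k f g => [|k IH] f g fg [cf df].
  split=> // x xU; rewrite /continuous_at -(fg x xU).
  by apply: cvg_trans (cf x xU); exact: near_eq_cvg (near_fg _ _ _ fg xU).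
split=> [x xU|i].
  rewrite /continuous_at -(fg x xU).
  by apply: cvg_trans (cf x xU); exact: near_eq_cvg (near_fg _ _ _ fg xU).
have [dfi Dfi] := df i; split=> [x xU|].
  by apply: near_eq_derivable (dfi x xU); exact: near_fg.
by apply: IH Dfi => x xU; apply: near_eq_derive; exact: near_fg.
Qed.

Lemma Ck_cst k U (c : W) : Ck k U (cst c).
Proof.
elim: k c => [|k IH] c; first by split=> // x _; exact: cst_continuous.
split=> [x _|i]; first exact: cst_continuous.
split=> [x _|]; first exact: derivable_cst.
rewrite (_ : (fun x => _) = cst 0) //.
by apply/funext => x; rewrite derive_cst.
Qed.

Lemma Ck_linear k U (a : R) f g :
  open U -> Ck k U f -> Ck k U g -> Ck k U (a *: f + g).
Proof.
move=> oU; elim: k f g => [|k IH] f g [cf df] [cg dg]; split => //.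
- by move=> x xU; apply: cvgD (cg x xU); apply: cvgZr (cf x xU).
- by move=> x xU; apply: cvgD (cg x xU); apply: cvgZr (cf x xU).
- move=> i; have [dfi Dfi] := df i; have [dgi Dgi] := dg i; split.
    move=> x xU; apply: derivableD (dgi x xU).
    exact: derivableZ (dfi x xU).
  apply: (@Ck_eq k U (a *: (fun x => 'D_(delta_mx 0 i) f x)
                      + (fun x => 'D_(delta_mx 0 i) g x))) => //.
    move=> x xU; rewrite deriveD ?deriveZ //; [exact: dfi| |exact: dgi].
    by apply: derivableZ; exact: dfi.
  exact: IH.
Qed.

End SmoothOn.

Lemma Ck_mul (R : realType) d k (U : set 'rV[R]_d) (f g : 'rV[R]_d -> R) :
  open U -> Ck k U f -> Ck k U g -> Ck k U (f * g).
Proof.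
move=> oU; elim: k f g => [|k IH] f g kf kg.
  by split=> // x xU; apply: cvgM (kf.1 x xU) (kg.1 x xU).
split=> [x xU|i]; first by apply: cvgM (kf.1 x xU) (kg.1 x xU).
have [dfi Dfi] := kf.2 i; have [dgi Dgi] := kg.2 i; split=> [x xU|].
  exact: derivableM (dfi x xU) (dgi x xU).
apply: (@Ck_eq _ _ _ k U (1 *: (f * (fun x => 'D_(delta_mx 0 i) g x))
                          + g * (fun x => 'D_(delta_mx 0 i) f x))) => //.
  by move=> x xU; rewrite scale1r deriveM //; [exact: dfi|exact: dgi].
by apply: Ck_linear => //; apply: IH => //; exact: CkS.
Qed.

Section Charts.
Variables (R : realType) (d : nat).

Record chart (M : topologicalType) := Chart {
  dom : set M;
  coord : M -> 'rV[R]_d;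
  param : 'rV[R]_d -> M;
  dom_open : open dom;
  img_open : open (coord @` dom);
  coordK : {in dom, cancel coord param};
  coord_cont : {in dom, continuous coord};
  param_cont : {in coord @` dom, continuous param} }.

Definition compatible (M : topologicalType) (c c' : chart M) :=
  smooth_on (coord c @` (dom c `&` dom c')) (coord c' \o param c).

Record manifold := Manifold {
  mtop :> topologicalType;
  atlas : set (chart mtop);
  manifold_neq0 : [set: mtop] !=set0;
  manifold_hausdorff : hausdorff_space mtop;
  manifold_second_countable : @second_countable mtop;
  atlas_cover : forall p : mtop, exists2 c, atlas c & dom c p;
  atlas_compatible :
    forall c c', atlas c -> atlas c' -> compatible c c' }.

End Charts.

Section SmoothFunctions.
Variables (R : realType) (d : nat) (M : manifold R d).

Definition smooth : set (M -> R^o) := [set f : M -> R^o |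
  forall c, atlas c -> smooth_on (coord c @` dom c) (f \o param c)].

Definition smooth_pred : {pred M -> R^o} := mem smooth.

Lemma smooth_subring : subring_closed smooth_pred.
Proof.
have lin (a : R) f g : smooth f -> smooth g -> smooth (a *: f + g).
  move=> sf sg c ac k; apply: Ck_linear; first exact: img_open.
    exact: sf.
  exact: sg.
split.
- by apply/mem_set => c _ k; exact: Ck_cst.
- move=> f g /set_mem sf /set_mem sg; apply/mem_set.
  by rewrite addrC -scaleN1r; exact: lin.
- move=> f g /set_mem sf /set_mem sg; apply/mem_set => c ac k.
  by apply: Ck_mul; [exact: img_open|exact: sf|exact: sg].
Qed.

HB.instance Definition _ :=
  GRing.isSubringClosed.Build (M -> R^o) smooth_pred smooth_subring.

Lemma smooth_scale : scaler_closed smooth_pred.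
Proof.
move=> a f /set_mem sf; apply/mem_set => c ac k.
rewrite -[_ \o _]addr0; apply: Ck_linear; first exact: img_open.
  exact: sf.
exact: Ck_cst.
Qed.

HB.instance Definition _ :=
  GRing.isScaleClosed.Build R (M -> R^o) smooth_pred smooth_scale.

Record smoothfun := SmoothFun {
  smoothfun_val :> M -> R^o;
  smoothfun_valP : smoothfun_val \in smooth_pred }.

HB.instance Definition _ := [isSub for smoothfun_val].
HB.instance Definition _ := [Choice of smoothfun by <:].
HB.instance Definition _ :=
  GRing.SubChoice_isSubComPzRing.Build (M -> R^o) smooth_pred smoothfun
    (subringClosedP smooth_pred).
HB.instance Definition _ := [SubZmodule_isSubLmodule of smoothfun by <:].

End SmoothFunctions.

Notation "''C^oo(' M )" := (smoothfun M) (format "''C^oo(' M )") : type_scope.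

(* Vector fields are the derivations of the algebra of smooth functions, and  *)
(* tensor fields are C^oo(M)-multilinear maps on them (as in Helgason,        *)
(* "Differential geometry, Lie groups, and symmetric spaces", chapter I).     *)
Section VectorFields.
Variables (R : realType) (d : nat) (M : manifold R d).

Definition derivation : set ('C^oo(M) -> 'C^oo(M)^o) :=
  [set X : 'C^oo(M) -> 'C^oo(M)^o |
  (forall (a : R) (f g : 'C^oo(M)),
    X (a *: f + g) = a *: (X f : 'C^oo(M)) + X g) /\
  (forall f g : 'C^oo(M), X (f * g) = X f * g + f * X g)].

Definition derivation_pred : {pred 'C^oo(M) -> 'C^oo(M)^o} := mem derivation.

Lemma smoothfun_scalerAl (a : R) (f g : 'C^oo(M)) : a *: (f * g) = (a *: f) * g.
Proof. by apply/val_inj/funext => p /=; rewrite [LHS]mulrA. Qed.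

Lemma smoothfun_scalerAr (a : R) (f g : 'C^oo(M)) : a *: (f * g) = f * (a *: g).
Proof. by rewrite mulrC smoothfun_scalerAl mulrC. Qed.

Lemma derivation_submod : submod_closed derivation_pred.
Proof.
split.
  apply/mem_set; split=> [a f g|f g]; first by rewrite scaler0 addr0.
  by rewrite mul0r mulr0 addr0.
move=> h X Y /set_mem [lX dX] /set_mem [lY dY].
apply/mem_set; split=> [a f g|f g].
  rewrite ![(h *: X + Y) _]/(h * X _ + Y _) lX lY mulrDr scalerDr addrACA.
  by rewrite -smoothfun_scalerAr.
rewrite ![(h *: X + Y) _]/(h * X _ + Y _) dX dY mulrDr mulrDl mulrDr addrACA.
by rewrite mulrA [h * (f * _)]mulrCA.
Qed.

HB.instance Definition _ :=
  GRing.isSubmodClosed.Build 'C^oo(M) ('C^oo(M) -> 'C^oo(M)^o) derivation_pred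
    derivation_submod.

Record vfield := VField {
  vfield_val :> 'C^oo(M) -> 'C^oo(M)^o;
  vfield_valP : vfield_val \in derivation_pred }.

HB.instance Definition _ := [isSub for vfield_val].
HB.instance Definition _ := [Choice of vfield by <:].
HB.instance Definition _ :=
  GRing.SubChoice_isSubLmodule.Build _ _ derivation_pred vfield
    (submodClosedP derivation_pred).

Lemma lie_derivation (X Y : vfield) :
  (fun f => X (Y f) - Y (X f)) \in derivation_pred.
Proof.
have [lX dX] := set_mem (vfield_valP X).
have [lY dY] := set_mem (vfield_valP Y).
have addX f g : X (f + g) = X f + X g by rewrite -[f in LHS]scale1r lX scale1r.
have addY f g : Y (f + g) = Y f + Y g by rewrite -[f in LHS]scale1r lY scale1r.
apply/mem_set; split=> [a f g|f g].
  by rewrite lX lY lX lY opprD addrACA scalerBr.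
by rewrite dX dY addX addY !dX !dY; ring.
Qed.

Definition lie (X Y : vfield) : vfield := VField (lie_derivation X Y).

(* X_p <> 0 *)
Definition nonzero_at (X : vfield) (p : M) := exists f, X f p != 0.

Definition oneform := {linear vfield -> 'C^oo(M)^o}.
Definition endofield := {linear vfield -> vfield}.

Definition extd (eta : oneform) (X Y : vfield) : 'C^oo(M) :=
  (2^-1 : R) *: (X (eta Y) - Y (eta X) - eta (lie X Y) : 'C^oo(M)).

Record riemannian := Riemannian {
  metric :> vfield -> vfield -> 'C^oo(M);
  metricC : forall X Y, metric X Y = metric Y X;
  metric_linear : forall (f : 'C^oo(M)) X Y Z,
    metric (f *: X + Y) Z = f * metric X Z + metric Y Z;
  metric_gt0 : forall X p, nonzero_at X p -> 0 < metric X X p }.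

Record connection := Connection {
  nabla :> vfield -> vfield -> vfield;
  nabla_linear : forall (f : 'C^oo(M)) X Y Z,
    nabla (f *: X + Y) Z = f *: nabla X Z + nabla Y Z;
  nablaD : forall X Y Z, nabla X (Y + Z) = nabla X Y + nabla X Z;
  nablaZ : forall (f : 'C^oo(M)) X Y,
    nabla X (f *: Y) = X f *: Y + f *: nabla X Y }.

Definition torsion_free (D : connection) :=
  forall X Y : vfield, D X Y - D Y X = lie X Y.

Definition metric_compatible (g : riemannian) (D : connection) :=
  forall X Y Z : vfield, Z (g X Y) = g (D Z X) Y + g X (D Z Y).

Definition levi_civita (g : riemannian) (D : connection) :=
  torsion_free D /\ metric_compatible g D.

Definition curvature (D : connection) (X Y Z : vfield) : vfield :=
  D X (D Y Z) - D Y (D X Z) - D (lie X Y) Z.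

(* (nabla_W R)(X, Y) Z *)
Definition nabla_curvature (D : connection) (W X Y Z : vfield) : vfield :=
  D W (curvature D X Y Z) - curvature D (D W X) Y Z
  - curvature D X (D W Y) Z - curvature D X Y (D W Z).

Definition locally_symmetric (D : connection) :=
  forall W X Y Z, nabla_curvature D W X Y Z = 0.

End VectorFields.

Section Contact.
Variables (R : realType) (n : nat) (M : manifold R n.*2.+1).

(* (eta /\ (d eta)^n)(X_0, ..., X_2n), up to a nonzero constant factor *)
Definition contact_volume (eta : oneform M)
    (X : 'I_n.*2.+1 -> vfield M) : 'C^oo(M) :=
  \sum_(s : 'S_n.*2.+1) (-1) ^+ s * eta (X (s ord0)) *
    \prod_(i < n) extd eta (X (s (inord i.*2.+1))) (X (s (inord i.*2.+2))).

Record contact_metric := ContactMetric {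
  eta : oneform M;
  xi : vfield M;
  phi : endofield M;
  gmet : riemannian M;
  contact_dim : (0 < n)%N;
  contact_form : forall p, exists X, contact_volume eta X p != 0;
  eta_xi : eta xi = 1;
  deta_xi : forall X, extd eta xi X = 0;
  eta_metric : forall X, eta X = gmet X xi;
  deta_metric : forall X Y, extd eta X Y = gmet X (phi Y);
  phi_phi : forall X, phi (phi X) = - X + eta X *: xi }.

Variables (S : contact_metric) (D : connection M).

Definition Nk_contact (k : R) := forall X Y,
  curvature D X Y (xi S) =
  (k *: (1 : 'C^oo(M))) *: (eta S Y *: X - eta S X *: Y).

Definition phi_recurrent := exists A : oneform M,
  (exists X, A X <> 0) /\
  forall X Y Z W, phi S (phi S (nabla_curvature D W X Y Z)) =
    A W *: curvature D X Y Z.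

Definition orthogonal_to_xi (X : vfield M) := gmet S X (xi S) = 0.

Definition locally_phi_symmetric := forall X Y Z W,
  orthogonal_to_xi X -> orthogonal_to_xi Y ->
  orthogonal_to_xi Z -> orthogonal_to_xi W ->
  phi S (phi S (nabla_curvature D W X Y Z)) = 0.

End Contact.

Arguments contact_metric {R} n M.

(* Main.v *)
Require Import Defs.
From mathcomp Require Import all_boot all_order all_algebra.
From mathcomp Require Import all_classical all_reals all_analysis.
From mathcomp Require Import ring.
Set Implicit Arguments.
Unset Strict Implicit.
Unset Printing Implicit Defensive.
Import Order.TTheory GRing.Theory Num.Theory.
Local Open Scope ring_scope.

(* Since phi^2 takes values in the orthogonal of xi, pairing the recurrence   *)
(* equation with xi gives A(W) k g(phi X, phi X) = 0, so k = 0 and            *)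
(* R(X, Y) xi = 0. Such a manifold is locally symmetric, in any dimension     *)
(* (Blair: it is locally E^(n+1) x S^n(4)). This is obtained here from global *)
(* vector fields only, without local frames. Let B X = nabla_X xi, whose      *)
(* adjoint is B + 2 phi. The hypothesis R(X, Y) xi = 0 says that              *)
(* (nabla_X B) Y is symmetric in X and Y. Along xi it reads nabla_xi B = -B^2 *)
(* and, with phi^2 = -1 + eta xi, forces B phi + phi B = -2 phi^2 and B^2 = 0.*)
(* Then phi B / 2 and B phi / 2 are the projections onto the two eigenbundles *)
(* of the tensor h, and comparing the components of nabla B along these       *)
(* bundles and xi gives (nabla_X B) Y = - g(B X, B Y) xi, hence phi B is      *)
(* parallel. Commuting R with B shows that                                    *)
(*   R(X, Y) Z - g(phi B Y, Z) phi B X + g(phi B X, Z) phi B Y                *)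
(* is an algebraic curvature tensor that commutes with B; such a tensor is 0. *)
(* So R is built from the parallel tensors g and phi B, and nabla R = 0.      *)

(** [phi_recurrent_k0] gives k = 0 from the recurrence and the nondegeneracy of d eta. When R(X, Y)
    xi = 0, the symmetry [CC] of nabla B leads to the algebraic relations [anticomm] and [B2], then
    to the derivatives [C_eq] and [nabla_phiB]. Finally [curvature_B] and the algebraic
    [curvature_tensor0] determine R in [curvature_eq], as an expression in parallel tensors. *)

Lemma eq_of_subr_eq (F : zmodType) (a b c d : F) :
  c = d -> a - b = c - d -> a = b.
Proof. by move=> -> ab; apply: subr0_eq; rewrite ab subrr. Qed.

(** * Multilinear algebra: symmetries that force a form to vanish *)

Section TernaryForms.
Variables (T : Type) (F : zmodType).
Hypothesis dbl_inj : forall a : F, a + a = 0 -> a = 0.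

(** Alternating the two swaps, three times each, restores the order of the arguments with sign
    (-1)^3. *)
Lemma sym_skew0 (t : T -> T -> T -> F) :
  (forall X Y Z, t X Y Z = t Y X Z) -> (forall X Y Z, t X Y Z = - t X Z Y) ->
  forall X Y Z, t X Y Z = 0.
Proof.
move=> sym skew X Y Z; apply: dbl_inj.
have e : t X Y Z = - t X Y Z.
  by rewrite [LHS]skew sym skew opprK sym skew sym.
by rewrite {1}e addNr.
Qed.
End TernaryForms.

Section CurvatureTensors.
Variables (F : comPzRingType) (V : lmodType F).
Hypothesis dbl_inj : forall a : F, a + a = 0 -> a = 0.
Variable r : V -> V -> V -> V -> F.
Hypothesis skew12 : forall X Y Z W, r X Y Z W = - r Y X Z W.
Hypothesis skew34 : forall X Y Z W, r X Y Z W = - r X Y W Z.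
Hypothesis bianchi : forall X Y Z W, r X Y Z W + r Y Z X W + r Z X Y W = 0.

(* The octahedron argument. *)
Lemma pair_sym X Y Z W : r X Y Z W = r Z W X Y.
Proof.
apply/subr0_eq/dbl_inj.
have b1 := bianchi X Y Z W; have b2 := bianchi Y Z W X.
have b3 := bianchi Z W X Y; have b4 := bianchi W X Y Z.
have -> : r X Y Z W - r Z W X Y + (r X Y Z W - r Z W X Y) =
    r X Y Z W + r Y Z X W + r Z X Y W + (r Y Z W X + r Z W Y X + r W Y Z X)
  - (r Z W X Y + r W X Z Y + r X Z W Y) - (r W X Y Z + r X Y W Z + r Y W X Z).
  rewrite (skew34 Y Z W X) (skew34 Z W Y X) (skew12 X Z W Y) (skew34 Z X W Y).
  rewrite (skew34 W X Y Z) (skew34 X Y W Z) (skew12 Y W X Z) (skew34 W Y X Z).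
  by ring.
by rewrite b1 b2 b3 b4 !subr0 addr0.
Qed.

Hypothesis r_linear : forall X Y Z f W W',
  r X Y Z (f *: W + W') = f * r X Y Z W + r X Y Z W'.
(** [Bt] models the adjoint of [B], so [r_adj] says that [r X Y], as an operator, commutes with [B];
    [p] and [q] model twice the projections onto the two eigenbundles. As [splitV] is doubled as
    well, [eta] stands for twice the contact form. *)
Variables (B Bt p q : V -> V) (xi : V) (eta : V -> F).
Hypothesis r_xi : forall X Y Z, r X Y Z xi = 0.
Hypothesis r_adj : forall X Y Z W, r X Y (B Z) W = r X Y Z (Bt W).
Hypothesis BtB : forall X, Bt (B X) = p X + p X.
Hypothesis BBt : forall X, B (Bt X) = q X + q X.
Hypothesis pq0 : forall X, p (q X) = 0.
Hypothesis qp0 : forall X, q (p X) = 0.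
Hypothesis qB : forall X, q (B X) = B X + B X.
Hypothesis pBt : forall X, p (Bt X) = Bt X + Bt X.
Hypothesis splitV : forall X, X + X = p X + q X + eta X *: xi.

(** The operators [r X Y] preserve the images of [p] and [q], so by pair symmetry mixed arguments in
    the first two slots give 0. Bianchi then kills [r (p _) (p _) (q _)], and since [B] maps into
    the image of [q], commuting with [B] carries this over to [r (p _) (p _) (p _)]; likewise with
    [p] and [q] exchanged. *)
Lemma curvature_tensor0 X Y Z W : r X Y Z W = 0.
Proof.
have dbl a b : a + a = b + b -> a = b :> F.
  by move=> /eqP; rewrite -subr_eq0 opprD addrACA => /eqP /dbl_inj/subr0_eq.
have r4D A1 A2 A3 A4 A4' :
    r A1 A2 A3 (A4 + A4') = r A1 A2 A3 A4 + r A1 A2 A3 A4'.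
  by rewrite -[A4 in LHS]scale1r r_linear mul1r.
have r40 A1 A2 A3 : r A1 A2 A3 0 = 0.
  by apply: (addrI (r A1 A2 A3 0)); rewrite -r4D !addr0.
have r4Z A1 A2 A3 f : r A1 A2 A3 (f *: xi) = 0.
  by rewrite -[_ *: _]addr0 r_linear r_xi r40 mulr0 addr0.
have r3D A1 A2 A3 A3' A4 :
    r A1 A2 (A3 + A3') A4 = r A1 A2 A3 A4 + r A1 A2 A3' A4.
  by rewrite skew34 r4D opprD -!skew34.
have r_adj' A1 A2 A3 A4 : r A1 A2 (Bt A3) A4 = r A1 A2 A3 (B A4).
  by rewrite skew34 -r_adj -skew34.
have rp A1 A2 A3 A4 : r A1 A2 (p A3) A4 = r A1 A2 A3 (p A4).
  by apply: dbl; rewrite -r3D -r4D -!BtB r_adj' r_adj.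
have rq A1 A2 A3 A4 : r A1 A2 (q A3) A4 = r A1 A2 A3 (q A4).
  by apply: dbl; rewrite -r3D -r4D -!BBt r_adj r_adj'.
have r34pq A1 A2 A3 A4 : r A1 A2 (p A3) (q A4) = 0 by rewrite rp pq0 r40.
have r34qp A1 A2 A3 A4 : r A1 A2 (q A3) (p A4) = 0 by rewrite rq qp0 r40.
have r12pq A1 A2 A3 A4 : r (p A1) (q A2) A3 A4 = 0 by rewrite pair_sym.
have r12qp A1 A2 A3 A4 : r (q A1) (p A2) A3 A4 = 0 by rewrite pair_sym.
have rppq A1 A2 A3 A4 : r (p A1) (p A2) (q A3) A4 = 0.
  by have := bianchi (p A1) (p A2) (q A3) A4; rewrite r12pq r12qp !addr0.
have rqqp A1 A2 A3 A4 : r (q A1) (q A2) (p A3) A4 = 0.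
  by have := bianchi (q A1) (q A2) (p A3) A4; rewrite r12pq r12qp !addr0.
have rppB A1 A2 A3 A4 : r (p A1) (p A2) (B A3) A4 = 0.
  by apply: dbl_inj; rewrite -r3D -qB rppq.
have rqqBt A1 A2 A3 A4 : r (q A1) (q A2) (Bt A3) A4 = 0.
  by apply: dbl_inj; rewrite -r3D -pBt rqqp.
have rppp A1 A2 A3 A4 : r (p A1) (p A2) (p A3) A4 = 0.
  by apply: dbl_inj; rewrite -r3D -BtB r_adj' rppB.
have rqqq A1 A2 A3 A4 : r (q A1) (q A2) (q A3) A4 = 0.
  by apply: dbl_inj; rewrite -r3D -BBt r_adj rqqBt.
have r3 A1 A2 A3 A4 : r A1 A2 (p A3) A4 = 0 -> r A1 A2 (q A3) A4 = 0 ->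
    r A1 A2 A3 A4 = 0.
  move=> r3p r3q; apply: dbl_inj.
  by rewrite -r3D splitV !r3D r3p r3q [r _ _ (_ *: _) _]skew34 r4Z oppr0 !addr0.
have r4 A1 A2 A3 A4 : r A1 A2 A3 (p A4) = 0 -> r A1 A2 A3 (q A4) = 0 ->
    r A1 A2 A3 A4 = 0.
  by move=> r4p r4q; rewrite skew34 r3 ?oppr0 // skew34 (r4p, r4q) oppr0.
rewrite pair_sym; apply: (r4); apply: (r3); rewrite pair_sym ?r12pq ?r12qp //.
- by apply: (r3); rewrite (rppp, rppq).
- by apply: (r3); rewrite (rqqp, rqqq).
Qed.
End CurvatureTensors.

(** * Vector fields, metrics and the Levi-Civita connection *)

Section RiemannianGeometry.
Variables (R : realType) (d : nat) (M : manifold R d).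
Local Notation F := 'C^oo(M).
Local Notation V := (vfield M).
Implicit Types (f h : F) (X Y Z W : V).

Lemma smoothfun_dbl_inj f : f + f = 0 -> f = 0.
Proof.
by move=> ff0; rewrite -[f]scale1r [1](splitr 1) scalerDl -scalerDr ff0 scaler0.
Qed.

Lemma vfield_funM X f h : X (f * h) = X f * h + f * X h.
Proof. by have [_ ->] := set_mem (vfield_valP X). Qed.

Lemma vfield_funD X f h : X (f + h) = X f + X h.
Proof.
by have [l _] := set_mem (vfield_valP X); rewrite -[f in LHS]scale1r l scale1r.
Qed.

Lemma vfield_fun0 X : X 0 = 0.
Proof. by apply: (addrI (X 0)); rewrite -vfield_funD !addr0. Qed.

Lemma vfield_funN X f : X (- f) = - X f.
Proof. by apply: (addrI (X f)); rewrite -vfield_funD !subrr vfield_fun0. Qed.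

Lemma vfield_fun1 X : X 1 = 0.
Proof.
apply: (addrI (X 1)).
by rewrite addr0 -[in RHS](mulr1 1) vfield_funM mulr1 mul1r.
Qed.

Lemma vfield_dbl_inj X : X + X = 0 -> X = 0.
Proof.
move=> XX0; apply/val_inj/funext => f; apply: smoothfun_dbl_inj.
by rewrite -[LHS]/((X + X) f) XX0.
Qed.

Lemma dbl_fun_inj f h : f + f = h + h -> f = h.
Proof.
move=> e; apply/subr0_eq/smoothfun_dbl_inj.
by rewrite addrACA e -opprD subrr.
Qed.

Lemma dbl_vfield_inj X Y : X + X = Y + Y -> X = Y.
Proof.
move=> e; apply/subr0_eq/vfield_dbl_inj.
by rewrite addrACA e -opprD subrr.
Qed.

Lemma lieC X Y : lie Y X = - lie X Y.
Proof.
apply/val_inj/funext => f.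
by rewrite /= -[RHS]/(- (X (Y f) - Y (X f))) opprB.
Qed.

Lemma jacobi X Y Z : lie X (lie Y Z) + lie Y (lie Z X) + lie Z (lie X Y) = 0.
Proof.
apply/val_inj/funext => f.
change (X (Y (Z f) - Z (Y f)) - (Y (Z (X f)) - Z (Y (X f)))
  + (Y (Z (X f) - X (Z f)) - (Z (X (Y f)) - X (Z (Y f))))
  + (Z (X (Y f) - Y (X f)) - (X (Y (Z f)) - Y (X (Z f)))) = 0 :> F).
by rewrite !vfield_funD !vfield_funN; ring.
Qed.

Variable g : riemannian M.

Lemma metricDl X Y Z : g (X + Y) Z = g X Z + g Y Z.
Proof. by rewrite -[X]scale1r metric_linear mul1r scale1r. Qed.

Lemma metricDr X Y Z : g Z (X + Y) = g Z X + g Z Y.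
Proof. by rewrite metricC metricDl ![g _ Z]metricC. Qed.

Lemma metric0l Z : g 0 Z = 0.
Proof. by apply: (addrI (g 0 Z)); rewrite -metricDl !addr0. Qed.

Lemma metric0r Z : g Z 0 = 0.
Proof. by rewrite metricC metric0l. Qed.

Lemma metricZl f X Z : g (f *: X) Z = f * g X Z.
Proof. by rewrite -[f *: X]addr0 metric_linear metric0l addr0. Qed.

Lemma metricZr f X Z : g Z (f *: X) = f * g Z X.
Proof. by rewrite metricC metricZl metricC. Qed.

Lemma metricNl X Z : g (- X) Z = - g X Z.
Proof. by rewrite -scaleN1r metricZl mulN1r. Qed.

Lemma metricNr X Z : g Z (- X) = - g Z X.
Proof. by rewrite metricC metricNl metricC. Qed.

Definition metricE := 
  (metric0l, metric0r, metricDl, metricDr, metricNl, metricNr, metricZl,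
   metricZr).

Lemma metric_eq0 X : g X X = 0 -> X = 0.
Proof.
move=> X0; apply/val_inj/funext => f; apply/val_inj/funext => p.
apply/eqP/negPn/negP => Xfp.
have : nonzero_at X p by exists f.
by move/(metric_gt0 g); rewrite X0 ltxx.
Qed.

(** Reduces identities between vector fields to identities in the ring of smooth functions, where
    [ring] applies. *)
Lemma metric_inj X Y : (forall Z, g X Z = g Y Z) -> X = Y.
Proof.
by move=> XY; apply/subr0_eq/metric_eq0; rewrite metricDl metricNl XY subrr.
Qed.

Variable D : connection M.

Lemma nablaDl X Y Z : D (X + Y) Z = D X Z + D Y Z.
Proof. by rewrite -[X]scale1r nabla_linear !scale1r. Qed.

Lemma nabla0l Z : D 0 Z = 0.
Proof. by apply: (addrI (D 0 Z)); rewrite -nablaDl !addr0. Qed.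

Lemma nablaZl f X Z : D (f *: X) Z = f *: D X Z.
Proof. by rewrite -[f *: X]addr0 nabla_linear nabla0l addr0. Qed.

Lemma nablaNl X Z : D (- X) Z = - D X Z.
Proof. by rewrite -scaleN1r nablaZl scaleN1r. Qed.

Lemma nabla0 X : D X 0 = 0.
Proof. by apply: (addrI (D X 0)); rewrite -nablaD !addr0. Qed.

Lemma nablaN X Z : D X (- Z) = - D X Z.
Proof. by apply: (addrI (D X Z)); rewrite -nablaD !subrr nabla0. Qed.

Lemma curvatureC X Y Z : curvature D Y X Z = - curvature D X Y Z.
Proof.
by rewrite /curvature lieC nablaNl !opprD !opprK [in RHS](addrC (- _)).
Qed.

(* Locked: otherwise rewriting with [metricDl] unifies it with a sum. *)
Definition nabla_op (T : V -> V) X Y : V := locked (D X (T Y) - T (D X Y)).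

Lemma nabla_opE (T : V -> V) X Y : nabla_op T X Y = D X (T Y) - T (D X Y).
Proof. by rewrite /nabla_op -lock. Qed.

Hypothesis LC : levi_civita g D.

Lemma nabla_metric X Y Z : Z (g X Y) = g (D Z X) Y + g X (D Z Y).
Proof. exact: LC.2. Qed.

Lemma lie_nabla X Y : lie X Y = D X Y - D Y X.
Proof. by rewrite LC.1. Qed.

Lemma first_bianchi X Y Z :
  curvature D X Y Z + curvature D Y Z X + curvature D Z X Y = 0.
Proof.
have := jacobi X Y Z; rewrite (lie_nabla X (lie _ _)) (lie_nabla Y (lie _ _)).
rewrite (lie_nabla Z (lie _ _)) => <-; rewrite /curvature.
rewrite (lie_nabla X Y) (lie_nabla Y Z) (lie_nabla Z X) !nablaD !nablaN.
by apply: metric_inj => U; rewrite !metricE; ring.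
Qed.

(** Metric compatibility expands both sides of [X, Y] g(Z, W) = X Y g(Z, W) - Y X g(Z, W). *)
Lemma curvature_skew X Y Z W :
  g (curvature D X Y Z) W = - g (curvature D X Y W) Z.
Proof.
have : lie X Y (g Z W) = X (Y (g Z W)) - Y (X (g Z W)) by [].
rewrite !(nabla_metric, vfield_funD) => e.
apply: (eq_of_subr_eq (esym e)); rewrite /curvature !metricE.
by rewrite !(metricC g Z); ring.
Qed.
End RiemannianGeometry.

(** * Contact metric identities for B, phi and their derivatives *)

Section ContactMetric.
Variables (R : realType) (n : nat) (M : manifold R n.*2.+1).
Variables (S : contact_metric n M) (D : connection M).
Hypothesis LC : levi_civita (gmet S) D.
Local Notation F := 'C^oo(M).
Local Notation V := (vfield M).
Local Notation g := (gmet S).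
Local Notation φ := (phi S).
Local Notation ξ := (xi S).
Local Notation B X := (D X ξ).
Implicit Types (f h : F) (X Y Z W U : V).

Lemma phiD X Y : φ (X + Y) = φ X + φ Y.
Proof. exact: linearD. Qed.

Lemma phiN X : φ (- X) = - φ X.
Proof. exact: linearN. Qed.

Lemma phiZ f X : φ (f *: X) = f *: φ X.
Proof. exact: linearZ. Qed.

Lemma extd_dbl X Y : extd (eta S) X Y + extd (eta S) X Y =
  X (eta S Y) - Y (eta S X) - eta S (lie X Y).
Proof. by rewrite /extd -scalerDl -[2^-1]mul1r -splitr scale1r. Qed.

Lemma extdC X Y : extd (eta S) Y X = - extd (eta S) X Y.
Proof.
apply/subr0_eq/smoothfun_dbl_inj.
rewrite opprK addrACA !extd_dbl lieC linearN; ring.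
Qed.

Lemma phi_skew X Y : g (φ X) Y = - g X (φ Y).
Proof. by rewrite metricC -!deta_metric extdC. Qed.

Lemma phi2 X : φ (φ X) = - X + g X ξ *: ξ.
Proof. by rewrite phi_phi eta_metric. Qed.

Lemma xi_xi : g ξ ξ = 1.
Proof. by rewrite -eta_metric eta_xi. Qed.

Lemma phi_xi_l X : g (φ X) ξ = 0.
Proof. by rewrite metricC -deta_metric deta_xi. Qed.

Lemma phi_xi : φ ξ = 0.
Proof.
apply: (metric_inj (g := g)) => Z.
by rewrite phi_skew metricC phi_xi_l metric0l oppr0.
Qed.

Lemma B_xi_l X : g (B X) ξ = 0.
Proof.
apply: smoothfun_dbl_inj.
by rewrite {2}metricC -(nabla_metric LC) xi_xi vfield_fun1.
Qed.

(** Twice d eta is the skew part g(B X, Y) - g(X, B Y), and d eta(X, Y) = g(X, phi Y). *)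
Lemma B_adj X Y : g (B X) Y = g X (B Y + φ Y + φ Y).
Proof.
have e : g X (φ Y) + g X (φ Y) = g (B X) Y - g X (B Y).
  rewrite -deta_metric extd_dbl !eta_metric !(nabla_metric LC) (lie_nabla LC).
  by rewrite !metricE (metricC g Y); ring.
by apply: (eq_of_subr_eq (esym e)); rewrite !metricE; ring.
Qed.

Lemma B_xi : B ξ = 0.
Proof.
apply: (metric_inj (g := g)) => Z.
rewrite B_adj !metricDr !(metricC g ξ) B_xi_l phi_xi_l metric0l.
by rewrite !addr0.
Qed.

Local Notation C := (nabla_op D (fun X => B X)).
Local Notation N := (nabla_op D φ).

Lemma CE X Y : C X Y = D X (B Y) - B (D X Y).
Proof. exact: nabla_opE. Qed.

Lemma NE X Y : N X Y = D X (φ Y) - φ (D X Y).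
Proof. exact: nabla_opE. Qed.

Lemma C_adj W X Y : g (C W X) Y = g X (C W Y + N W Y + N W Y).
Proof.
have e1 := congr1 (vfield_val W) (B_adj X Y).
have e2 := B_adj (D W X) Y; have e3 := B_adj X (D W Y).
rewrite !(nabla_metric LC) !nablaD in e1.
apply: (eq_of_subr_eq e1); rewrite !(CE, NE) [g (_ - _) _]metricDl metricNl.
by rewrite e2 e3 !metricE; ring.
Qed.

Lemma N_phi X Y : N X (φ Y) + φ (N X Y) = g (B X) Y *: ξ + g Y ξ *: B X.
Proof.
have e : D X (φ (φ Y)) = - D X Y + X (g Y ξ) *: ξ + g Y ξ *: B X.
  by rewrite phi2 nablaD nablaN nablaZ addrA.
rewrite !NE phiD phiN e phi2 (nabla_metric LC).
apply: (metric_inj (g := g)) => Z.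
by rewrite !metricE (metricC g Y (B X)); ring.
Qed.

Lemma CDr X Y Y' : C X (Y + Y') = C X Y + C X Y'.
Proof.
rewrite !CE nablaDl !nablaD nablaDl.
by apply: (metric_inj (g := g)) => Z; rewrite !metricE; ring.
Qed.

Lemma CZr f X Y : C X (f *: Y) = f *: C X Y.
Proof.
rewrite !CE nablaZl !nablaZ nablaDl !nablaZl.
by apply: (metric_inj (g := g)) => Z; rewrite !metricE; ring.
Qed.

Lemma C_xi_r X : C X ξ = - B (B X).
Proof. by rewrite !CE B_xi nabla0 sub0r. Qed.

Lemma B_scale_xi f : B (f *: ξ) = 0.
Proof. by rewrite nablaZl B_xi scaler0. Qed.

(** * The algebra of B and phi when R(X, Y) xi = 0 *)

Hypothesis R_xi : forall X Y, curvature D X Y ξ = 0.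

(** Without torsion, R(X, Y) xi = C X Y - C Y X. *)
Lemma CC X Y : C X Y = C Y X.
Proof.
have e := R_xi X Y; rewrite /curvature (lie_nabla LC) nablaDl nablaNl in e.
apply: (eq_of_subr_eq e); apply: (metric_inj (g := g)) => Z.
by rewrite !CE !metricE; ring.
Qed.

Lemma phiB2 X : φ (φ (B X)) = - B X.
Proof. by rewrite phi2 B_xi_l scale0r addr0. Qed.

Lemma Bphi2 X : B (φ (φ X)) = - B X.
Proof. by rewrite phi2 nablaDl nablaNl B_scale_xi addr0. Qed.

Lemma phi3 X : φ (φ (φ X)) = - φ X.
Proof. by rewrite phi2 phi_xi_l scale0r addr0. Qed.

(** Since [C ξ] is -B^2, [C_adj] makes 2 [N ξ] the difference of B^2 and its adjoint (B + 2
    phi)^2. *)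
Lemma N_xi Y : N ξ Y = - (B (φ Y) + φ (B Y) + φ (φ Y) + φ (φ Y)).
Proof.
apply/dbl_vfield_inj/(metric_inj (g := g)) => X; rewrite ![g (_ + _) X]metricC.
have e := C_adj ξ X Y; rewrite !(CC ξ) !C_xi_r in e.
have e2 := etrans (B_adj (B X) Y) (B_adj X _); rewrite !nablaDl !phiD in e2.
apply: (eq_of_subr_eq (esym e)); move: e2; rewrite !metricE => ->; ring.
Qed.

Lemma phiBphi Y : φ (B (φ Y)) = B Y + φ Y + φ Y.
Proof.
have e : N ξ (φ Y) + φ (N ξ Y) = 0.
  by rewrite N_phi B_xi metric0l scale0r scaler0 addr0.
apply/dbl_vfield_inj; move: e; rewrite !N_xi phiN !phiD phiB2 Bphi2 !phi3 => e.
apply: (eq_of_subr_eq (esym e)).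
by apply: (metric_inj (g := g)) => Z; rewrite !metricE; ring.
Qed.

Lemma anticomm Y : B (φ Y) = - (φ (B Y) + φ (φ Y) + φ (φ Y)).
Proof. by apply: oppr_inj; rewrite -phiB2 phiBphi !phiD opprK. Qed.

Lemma N_xi0 Y : N ξ Y = 0.
Proof.
rewrite N_xi anticomm.
by apply: (metric_inj (g := g)) => Z; rewrite !metricE; ring.
Qed.

Lemma nabla_xi_phi Y : D ξ (φ Y) = φ (D ξ Y).
Proof. by apply/subr0_eq; rewrite -NE N_xi0. Qed.

Lemma nabla_xi_B Y : D ξ (B Y) = B (D ξ Y) - B (B Y).
Proof.
apply: (eq_of_subr_eq (CC ξ Y)); rewrite C_xi_r !CE.
by apply: (metric_inj (g := g)) => Z; rewrite !metricE; ring.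
Qed.

(** Differentiating [anticomm] along xi, where phi is parallel and nabla B = -B^2, gives B^2 phi = -
    phi B^2, whereas applying [anticomm] twice gives B^2 phi = phi B^2. *)
Lemma B2 Y : B (B Y) = 0.
Proof.
have e := congr1 (D ξ) (anticomm Y).
rewrite nablaN !nablaD !nabla_xi_phi !nabla_xi_B !nabla_xi_phi in e.
have e1 : B (B (φ Y)) = φ (B (B Y)).
  rewrite (anticomm Y) nablaNl !nablaDl (anticomm (B Y)) Bphi2 phiB2.
  by apply: (metric_inj (g := g)) => Z; rewrite !metricE; ring.
have e2 : φ (B (B Y)) = 0.
  apply: vfield_dbl_inj; apply: (eq_of_subr_eq (esym e)).
  rewrite e1 anticomm phiD phiN.
  by apply: (metric_inj (g := g)) => Z; rewrite !metricE; ring.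
by apply: oppr_inj; rewrite -phiB2 e2 linear0 oppr0.
Qed.

(** * Components of nabla B along the eigenbundles and xi *)

Lemma C_B X Y : C X (B Y) = - B (C X Y).
Proof. by rewrite !CE B2 nabla0 nablaDl nablaNl B2 subr0 sub0r. Qed.

Lemma C_xi X : C X ξ = 0.
Proof. by rewrite C_xi_r B2 oppr0. Qed.

Lemma C_normal X Y : g (C X Y) ξ = - g (B X) (B Y).
Proof.
have := nabla_metric LC (B Y) ξ X; rewrite B_xi_l vfield_fun0 => e.
apply: (eq_of_subr_eq (esym e)).
by rewrite !CE !metricE B_xi_l (metricC g (B X)); ring.
Qed.

Lemma BphiB Y : B (φ (B Y)) = B Y + B Y.
Proof. by rewrite anticomm B2 linear0 !phiB2 add0r -opprD opprK. Qed.

Lemma phiB_sym X Y : g (φ (B X)) Y = g X (φ (B Y)).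
Proof. by rewrite phi_skew B_adj anticomm !metricE; ring. Qed.

Lemma B_isom X Y : g (B X) (B Y) = g X (φ (B Y)) + g X (φ (B Y)).
Proof. by rewrite B_adj B2 add0r metricDr. Qed.

Lemma C_B_B X Y : C (B X) (B Y) = 0.
Proof. by rewrite C_B CC C_B nablaNl B2 !oppr0. Qed.

Lemma C_B_phiB X Y Z : g (C X (B Y)) (φ (B Z)) = 0.
Proof.
by rewrite C_B metricNl B_adj BphiB !phiB2 -addrA -opprD subrr metric0r oppr0.
Qed.

(* Differentiating phi^2 = -1 + eta xi makes phi (nabla_X phi) skew on the    *)
(* orthogonal of xi.                                                          *)
Lemma N_skew X Y Z : g Y ξ = 0 -> g Z ξ = 0 ->
  g (φ Y) (N X Z) = - g (φ Z) (N X Y).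
Proof.
move=> Y0 Z0; have := congr1 (fun U => g U Z) (N_phi X Y).
rewrite /= Y0 !metricDl !metricZl mul0r addr0 (metricC g ξ) Z0 mulr0 phi_skew.
have e : g (N X (φ Y)) Z = - g (φ Y) (N X Z).
  have := congr1 (vfield_val X) (phi_skew (φ Y) Z).
  rewrite vfield_funN !(nabla_metric LC) => e1.
  apply: (eq_of_subr_eq e1); rewrite !NE !metricE !phi_skew; ring.
rewrite e => e1; apply: (eq_of_subr_eq (esym e1)).
by rewrite (metricC g (φ Z)); ring.
Qed.

Lemma C_phiB_B_skew X Y Z :
  g (C X (φ (B Y))) (B Z) = - g (C X (φ (B Z))) (B Y).
Proof.
have NC U W : g (C X (φ (B U))) (B W) =
    g (φ (φ (B W))) (N X (φ (B U))) + g (φ (φ (B W))) (N X (φ (B U))).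
  have := C_adj X (B W) (φ (B U)); rewrite C_B_phiB => e.
  apply: (eq_of_subr_eq (esym e)).
  by rewrite phiB2 !metricE !(metricC g (B W)); ring.
rewrite !NC [X in X + _]N_skew ?phi_xi_l //.
by rewrite [X in _ + X]N_skew ?phi_xi_l // opprD.
Qed.

Lemma C_phiB_phiB_B X Y Z : g (C (φ (B X)) (φ (B Y))) (B Z) = 0.
Proof.
apply: (sym_skew0 (@smoothfun_dbl_inj _ _ _)
  (t := fun X Y Z => g (C (φ (B X)) (φ (B Y))) (B Z))) => *.
  by rewrite CC.
exact: C_phiB_B_skew.
Qed.

(** By [BphiB], 2 B X = B (phi B X), and [C_B] moves this B outside. The right side is symmetric in
    X and Y by [CC]. *)
Lemma C_B_phiB_twice X Y Z :
  g (C (B X) (φ (B Y))) (B Z) + g (C (B X) (φ (B Y))) (B Z) =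
  - g (B (C (φ (B Y)) (φ (B X)))) (B Z).
Proof. by rewrite -metricDl CC -CDr -BphiB C_B metricNl. Qed.

Lemma C_B_phiB_B X Y Z : g (C (B X) (φ (B Y))) (B Z) = 0.
Proof.
apply: (sym_skew0 (@smoothfun_dbl_inj _ _ _)
  (t := fun X Y Z => g (C (B X) (φ (B Y))) (B Z))) => [X' Y' Z'|*].
  apply/subr0_eq/smoothfun_dbl_inj.
  by rewrite addrACA -opprD !C_B_phiB_twice CC subrr.
exact: C_phiB_B_skew.
Qed.

Lemma C_phiB_phiB_phiB X Y Z : g (C (φ (B X)) (φ (B Y))) (φ (B Z)) = 0.
Proof.
apply: smoothfun_dbl_inj; apply: oppr_inj; rewrite oppr0.
(* The left side vanishes by [C_B_phiB_B]; moving B across the metric turns B Z into 2 phi B Z. *)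
have := C_B_phiB_twice Y X Z.
by rewrite C_B_phiB_B addr0 B_adj B2 add0r metricDr.
Qed.

Lemma split2 X : X + X = φ (B X) + B (φ X) + (g X ξ + g X ξ) *: ξ.
Proof.
rewrite anticomm phi2.
by apply: (metric_inj (g := g)) => Z; rewrite !metricE; ring.
Qed.

Lemma C_split X Y Z : g (C X (φ (B Y))) Z = 0 -> g (C X (B (φ Y))) Z = 0 ->
  g (C X Y) Z = 0.
Proof.
move=> e1 e2; apply: smoothfun_dbl_inj.
rewrite -metricDl -CDr split2 !CDr !metricDl.
by rewrite e1 e2 CZr C_xi scaler0 metric0l !addr0.
Qed.

Lemma C_phiB_0 X Y Z : g (C X Y) (φ (B Z)) = 0.
Proof.
apply: C_split; last exact: C_B_phiB.
by rewrite CC; apply: C_split; [exact: C_phiB_phiB_phiB|exact: C_B_phiB].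
Qed.

Lemma C_B_0 X Y Z : g (C X Y) (B Z) = 0.
Proof.
apply: C_split; rewrite CC; apply: C_split.
- exact: C_phiB_phiB_B.
- by rewrite CC C_B_phiB_B.
- exact: C_B_phiB_B.
- by rewrite C_B_B metric0l.
Qed.

Lemma C_eq X Y : C X Y = - (g (B X) (B Y) *: ξ).
Proof.
apply: (metric_inj (g := g)) => Z; apply: dbl_fun_inj.
rewrite -metricDr split2 !metricDr C_phiB_0 C_B_0 metricZr C_normal.
by rewrite !metricE (metricC g ξ Z); ring.
Qed.

Lemma nabla_B X Y : D X (B Y) = B (D X Y) - g (B X) (B Y) *: ξ.
Proof. by rewrite -C_eq CE addrC subrK. Qed.

(** In [C_adj] both terms in [C] vanish, as nabla B only has a component along xi. *)
Lemma N_B X Y : N X (B Y) = 0.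
Proof.
apply/vfield_dbl_inj/(metric_inj (g := g)) => Z.
have := C_adj X Z (B Y).
rewrite C_B_0 C_B C_eq nablaNl B_scale_xi !oppr0 add0r => e.
by rewrite metric0l e metricC.
Qed.

Lemma nabla_phiB X Y : D X (φ (B Y)) = φ (B (D X Y)).
Proof.
have /eqP := N_B X Y; rewrite NE subr_eq0 => /eqP ->.
by rewrite nabla_B phiD phiN phiZ phi_xi scaler0 oppr0 addr0.
Qed.

(** * The curvature tensor *)

Lemma curvature_B X Y Z : curvature D X Y (B Z) =
  B (curvature D X Y Z) - g (B Y) (B Z) *: B X + g (B X) (B Z) *: B Y.
Proof.
(* The xi-component h vanishes because R(X, Y) xi = 0. *)
set h := - g (B X) (B (D Y Z)) - X (g (B Y) (B Z)) + g (B Y) (B (D X Z))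
  + Y (g (B X) (B Z)) + g (B (lie X Y)) (B Z).
have e : curvature D X Y (B Z) = B (curvature D X Y Z)
    - g (B Y) (B Z) *: B X + g (B X) (B Z) *: B Y + h *: ξ.
  rewrite /curvature !(nabla_B, nablaDl, nablaNl, nablaD, nablaN, nablaZ).
  by apply: (metric_inj (g := g)) => U; rewrite /h !metricE; ring.
have h0 : h = 0.
  have := congr1 (fun U => g U ξ) e; rewrite /= (curvature_skew LC) R_xi.
  by rewrite !metricE !B_xi_l xi_xi !mulr0 mulr1 oppr0 !add0r.
by rewrite e h0 scale0r addr0.
Qed.

(** Half of phi B is an orthogonal projection, so the right side has constant curvature 4 on its
    image: the sphere factor. *)
Lemma curvature_eq X Y Z : curvature D X Y Z =
  g (φ (B Y)) Z *: φ (B X) - g (φ (B X)) Z *: φ (B Y).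
Proof.
pose r X Y Z W := g (curvature D X Y Z) W
  - g (φ (B Y)) Z * g (φ (B X)) W + g (φ (B X)) Z * g (φ (B Y)) W.
suff r0 X' Y' Z' W : r X' Y' Z' W = 0.
  apply: (metric_inj (g := g)) => W; apply: (eq_of_subr_eq (r0 X Y Z W)).
  by rewrite /r !metricE; ring.
move: X' Y' Z' W => {X Y Z}.
apply: (@curvature_tensor0 _ _ _ r _ _ _ _ (fun X => B X)
  (fun X => B X + φ X + φ X) (fun X => φ (B X)) (fun X => B (φ X)) ξ
  (fun X => g X ξ + g X ξ)).
- exact: smoothfun_dbl_inj.
- by move=> X Y Z W; rewrite /r curvatureC metricNl; ring.
- by move=> X Y Z W; rewrite /r (curvature_skew LC); ring.
- move=> X Y Z W.
  apply: (eq_of_subr_eq (congr1 (fun U => g U W) (first_bianchi LC X Y Z))).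
  rewrite /r !metricE [g (φ (B X)) Z]phiB_sym [g (φ (B Y)) X]phiB_sym.
  rewrite [g (φ (B Z)) Y]phiB_sym !(metricC g _ (φ _)); ring.
- by move=> X Y Z f W W'; rewrite /r !metricE; ring.
- move=> X Y Z; rewrite /r (curvature_skew LC) R_xi !phi_xi_l !mulr0 metric0l.
  by rewrite oppr0 !add0r.
(* The correction terms of [curvature_B] are exactly the commutator of the right side with B. *)
- move=> X Y Z W; rewrite /r curvature_B; move: (curvature D X Y Z) => K.
  rewrite ![g (φ _) (B Z)]phiB_sym B2 linear0 !metric0r !mul0r subr0 addr0.
  rewrite -!B_adj !BphiB !B_isom -!phiB_sym !metricE; ring.
- by move=> X; rewrite B2 add0r.
- by move=> X; rewrite !nablaDl B2 add0r.
- by move=> X; rewrite B2 linear0.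
- by move=> X; rewrite phiB2 nablaNl B2 oppr0.
- exact: BphiB.
- move=> X; rewrite !nablaDl B2 add0r phiD phiBphi.
  by apply: (metric_inj (g := g)) => Z; rewrite !metricE; ring.
- exact: split2.
Qed.

Lemma locally_symmetric_of_flat_xi : locally_symmetric D.
Proof.
move=> W X Y Z; rewrite /nabla_curvature !curvature_eq.
rewrite nablaD nablaN !nablaZ !(nabla_metric LC) !nabla_phiB.
by apply: (metric_inj (g := g)) => U; rewrite !metricE; ring.
Qed.
End ContactMetric.

(** * Recurrence forces k = 0 *)

Section PhiRecurrent.
Variables (R : realType) (n : nat) (M : manifold R n.*2.+1).
Variables (S : contact_metric n M) (D : connection M) (k : R).
Hypothesis LC : levi_civita (gmet S) D.
Local Notation F := 'C^oo(M).
Local Notation V := (vfield M).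
Local Notation g := (gmet S).
Local Notation φ := (phi S).
Local Notation ξ := (xi S).
Implicit Types (f : F) (X Y Z W U : V).

Lemma extd_nondegenerate f : (forall X Y, f * extd (eta S) X Y = 0) -> f = 0.
Proof.
move=> f0; apply/val_inj/funext => p; apply/eqP/negPn/negP => fp.
have [X /negP[]] := contact_form S p.
have : (f * contact_volume (eta S) X) p == 0.
  rewrite /contact_volume mulr_sumr big1 // => s _.
  (* As n > 0, every term of the contact volume contains a factor d eta. *)
  have [m En] : exists m, n = m.+1.
    by case: (n) (contact_dim S) => // m; exists m.
  pose i0 : 'I_n := cast_ord (esym En) ord0.
  by rewrite (bigD1 i0) //= [X in f * X]mulrCA !mulrA f0 !mul0r.
by rewrite -[(f * _) p]/(f p * _ p) mulf_eq0 (negPf fp).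
Qed.

Hypothesis Nk : Nk_contact S D k.

Lemma phi_recurrent_k0 : phi_recurrent S D -> k = 0.
Proof.
move=> [A [[W AW0] rec]]; apply/eqP/negPn/negP => k0; apply: AW0.
have Aphi X : A W *: φ X = 0.
  apply: (metric_eq0 (g := g)); rewrite metricZl metricZr.
  (* These arguments make the xi-component of the right side - A(W) k g(phi X, phi X). *)
  have := congr1 (fun U => g U ξ) (rec (φ X) ξ (φ X) W).
  rewrite /= phi_xi_l metricZl (curvature_skew LC) Nk.
  rewrite !eta_metric xi_xi phi_xi_l scale1r scale0r subr0 metricZl.
  rewrite mulrN => /esym/eqP; rewrite oppr_eq0.
  rewrite -smoothfun_scalerAl mul1r -smoothfun_scalerAr scaler_eq0.
  by rewrite (negPf k0) /= => /eqP ->; rewrite mulr0.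
apply: extd_nondegenerate => X Y.
by rewrite deta_metric -metricZr Aphi metric0r.
Qed.

Lemma phi_recurrent_locally_symmetric :
  phi_recurrent S D -> locally_symmetric D.
Proof.
move=> /phi_recurrent_k0 k0; apply: (locally_symmetric_of_flat_xi LC) => X Y.
by rewrite Nk k0 scale0r scale0r.
Qed.
End PhiRecurrent.

Theorem theorem3p8 (R : realType) (M : manifold R 3)
    (S : contact_metric 1 M) (D : connection M) (k : R) :
  levi_civita (gmet S) D ->
  Nk_contact S D k ->
  phi_recurrent S D ->
  ~ (~ locally_symmetric D /\ ~ locally_phi_symmetric S D).
Proof.
move=> LC Nk rec [notsym _]; apply: notsym.
exact: phi_recurrent_locally_symmetric LC Nk rec.
Qed.
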